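(* Let $X$ be a continuum. Then $\mathcal{T}\colon 2^X\to 2^X$ is continuous if and only if $\mathcal{T}$ is idempotent on closed sets and $\mathcal{T}(2^X)=\{\mathcal{T}(A):A\in 2^X\}$ is closed in $2^X$.
   Context: A continuum is a compact, connected, nonempty metric space; a subcontinuum of $X$ is a subset of $X$ that is a continuum. For a continuum $X$, $2^X$ denotes the set of all nonempty closed subsets of $X$ with the Hausdorff metric. Jones' set function $\mathcal{T}$ is defined for every $A\subseteq X$ by $$\mathcal{T}(A)=X\setminus\{x\in X : \text{there is a subcontinuum } W \text{ of } X \text{ with } x\in W^{\circ}\subseteq W\subseteq X\setminus A\},$$ where $W^\circ$ is the interior of $W$ in $X$. If $A\in 2^X$ then $\mathcal{T}(A)\in 2^X$, and continuity of $\mathcal{T}$ refers to its restriction $2^X\to 2^X$. $\mathcal{T}$ is idempotent on closed sets if $\mathcal{T}(\mathcal{T}(A))=\mathcal{T}(A)$ for each $A\in 2^X$. *)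

(* Defs.v *)
From HB Require Import structures.
From mathcomp Require Import all_boot all_order all_algebra.
From mathcomp Require Import all_classical all_reals all_analysis.

Set Implicit Arguments.
Unset Strict Implicit.
Unset Printing Implicit Defensive.

Import Order.TTheory GRing.Theory Num.Theory.
Import numFieldNormedType.Exports.

Local Open Scope classical_set_scope.
Local Open Scope ring_scope.

(* [W] is a continuum for the metric induced by [X]; this also covers the
   whole space, as [continuum [set: X]]. *)
Definition continuum (R : realType) (X : metricType R) (W : set X) : Prop :=
  [/\ compact W, connected W & W !=set0].

Definition jones (R : realType) (X : metricType R) (A : set X) : set X :=
  ~` [set x | exists W : set X,
        [/\ continuum W, W° x, W° `<=` W & W `<=` ~` A]].

(* The proof argument [cX] keeps the boundedness of [X] at hand, which the
   Hausdorff distance needs to satisfy the triangle inequality. *)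
Record hyperspace (R : realType) (X : metricType R)
    (cX : continuum [set: X]) := Hyperspace {
  hset :> set X ;
  hset_closed : closed hset ;
  hset_neq0 : hset !=set0
}.

Definition thickening (R : realType) (X : metricType R) (e : R) (A : set X)
    : set X :=
  \bigcup_(a in A) [set x | mdist a x < e].

Definition hausdorff_dist (R : realType) (X : metricType R) (A B : set X) : R :=
  inf [set e | [/\ 0 < e, A `<=` thickening e B & B `<=` thickening e A]].

Section hyperspace_metric.
Context (R : realType) (X : metricType R) (cX : continuum [set: X]).
Local Notation H := (hyperspace cX).
Implicit Types A B C : H.

HB.instance Definition _ := gen_eqMixin H.
HB.instance Definition _ := gen_choiceMixin H.

Lemma hyperspace_ext A B : hset A = hset B -> A = B.
Proof.
case: A B => [A cA nA] [B cB nB] /= AB; subst B.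
by rewrite (Prop_irrelevance cA cB) (Prop_irrelevance nA nB).
Qed.

Lemma continuum_bounded : exists2 M : R, 0 < M & forall x y : X, mdist x y < M.
Proof.
have [cT _ [x0 _]] := cX.
have cf : continuous (fun x : X => mdist x0 x : R).
  move=> x; apply/cvgrPdist_lt => e e0; near=> y.
  have yx : mdist x y < e.
    near: y; have := nbhsx_ballx x e e0; by rewrite ballEmdist.
  rewrite ltr_norml; apply/andP; split.
    rewrite ltrNl opprB ltrBlDl (le_lt_trans (metric_triangle x0 x y))//.
    by rewrite ltrD2l.
  rewrite ltrBlDl (le_lt_trans (metric_triangle x0 y x))//.
  by rewrite ltrD2l metric_sym.
have : compact ((fun x : X => mdist x0 x : R^o) @` setT).
  by apply: continuous_compact => //; exact: continuous_subspaceT.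
move=> /compact_bounded [N [_ /(_ (`|N| + 1))]].
rewrite (le_lt_trans (ler_norm N)) ?ltrDl// => /(_ isT) bN.
have {}bN x : mdist x0 x < `|N| + 2.
  rewrite (@le_lt_trans _ _ (`|N| + 1)) ?ltrD2l ?ltr1n//.
  by rewrite (le_trans (ler_norm _))//; apply: bN; exists x.
exists ((`|N| + 2) + (`|N| + 2)) => [|x y].
  by rewrite addr_gt0// ltr_wpDl.
by rewrite (le_lt_trans (metric_triangle x x0 y))// ltrD// metric_sym.
Unshelve. all: by end_near. Qed.

Let Eset A B :=
  [set e : R | [/\ 0 < e, A `<=` thickening e B & B `<=` thickening e A]].

Let Eset_inf A B : has_inf (Eset A B).
Proof.
split; last by exists 0 => e [/ltW].
have [M M0 bM] := continuum_bounded.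
have [[a Aa] [b Bb]] := (hset_neq0 A, hset_neq0 B).
by exists M; split => // x _; [exists b|exists a] => //; apply: bM.
Qed.

Lemma hausdorff_distxx A : hausdorff_dist A A = 0.
Proof.
have [_ lbA] := Eset_inf A A.
apply/eqP; rewrite eq_le; apply/andP; split.
  apply/ler_addgt0Pl => e e0; rewrite addr0; apply: ge_inf => //.
  by split=> // x Ax; exists x => //=; rewrite mdistxx.
apply: lb_le_inf; first by case: (Eset_inf A A).
by move=> e [/ltW].
Qed.

Lemma hausdorff_dist_sym A B : hausdorff_dist A B = hausdorff_dist B A.
Proof.
by congr inf; apply/seteqP; split=> e [? ? ?]; split.
Qed.

Let hausdorff_dist_sub A B : hausdorff_dist A B = 0 -> hset A `<=` hset B.
Proof.
move=> AB0 x Ax; apply: (hset_closed (h := B)) => U /nbhs_ballP[e /= e0 eU].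
have [d [_ AB _] de] := inf_adherent e0 (Eset_inf A B).
have [b Bb /= bx] := AB _ Ax.
exists b; split=> //; apply: eU; rewrite ballEmdist/= metric_sym.
rewrite (lt_trans bx)// (lt_le_trans de)//.
by rewrite -/(hausdorff_dist A B) AB0 add0r.
Qed.

Lemma hausdorff_dist_positivity A B : hausdorff_dist A B = 0 -> A = B.
Proof.
move=> AB0; apply: hyperspace_ext; apply/seteqP; split.
  exact: hausdorff_dist_sub.
by apply: hausdorff_dist_sub; rewrite hausdorff_dist_sym.
Qed.

Let thickeningD (d e : R) (A B C : set X) :
  A `<=` thickening d B -> B `<=` thickening e C -> A `<=` thickening (d + e) C.
Proof.
move=> AB BC x /AB[b /BC[c Cc /= cb] /= bx]; exists c => //=.
by rewrite (le_lt_trans (metric_triangle c b x))// addrC ltrD.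
Qed.

Lemma hausdorff_dist_triangle B A C :
  hausdorff_dist A C <= hausdorff_dist A B + hausdorff_dist B C.
Proof.
apply/ler_addgt0Pl => e e0; have e20 : 0 < e / 2 by rewrite divr_gt0.
have [d [d0 AB BA] dlt] := inf_adherent e20 (Eset_inf A B).
have [f [f0 BC CB] flt] := inf_adherent e20 (Eset_inf B C).
apply: (@le_trans _ _ (d + f)).
  apply: ge_inf; first by case: (Eset_inf A C).
  split; first exact: addr_gt0.
    exact: thickeningD AB BC.
  by rewrite addrC; exact: thickeningD CB BA.
rewrite (le_trans (ltW (ltrD dlt flt)))// addrACA -splitr.
by rewrite addrC.
Qed.

HB.instance Definition _ := @isMetric.Build R H
  (fun A B => hausdorff_dist A B) hausdorff_distxx hausdorff_dist_positivity
  hausdorff_dist_sym hausdorff_dist_triangle.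

Lemma mdist_hyperspaceE A B : mdist A B = hausdorff_dist A B.
Proof. by []. Qed.

Lemma jones_closed (A : set X) : closed (jones A).
Proof.
apply: open_closedC; rewrite openE => x [W [cW Wx sW WA]].
apply: filterS (open_nbhs_nbhs (conj (open_interior W) Wx)) => y Wy.
by exists W.
Qed.

Lemma subset_jones (A : set X) : A `<=` jones A.
Proof. by move=> x Ax [W [_ Wx sW]] /(_ x (sW _ Wx)). Qed.

Lemma jones_neq0 (A : set X) : A !=set0 -> jones A !=set0.
Proof. by case=> x Ax; exists x; exact: subset_jones. Qed.

Definition jones_hyperspace (A : H) : H :=
  Hyperspace cX (@jones_closed A) (jones_neq0 (hset_neq0 A)).

End hyperspace_metric.

Arguments jones_hyperspace {R X} cX A.

Definition idempotent_on_closed (R : realType) (X : metricType R) : Prop :=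
  forall A : set X, closed A -> A !=set0 -> jones (jones A) = jones A.

(* Main.v *)
(** Let [T] be continuous and [W] a subcontinuum. If a closed set [A] misses
    [W°], then [A] is a limit of closed sets missing [W]; the images of these
    miss [W°], hence so does [T A]. Now let [x] be outside [T A], and take [W]
    with [x] in [W°] and [W] missing [A]. Then [T A] misses [W°], and the
    complement of [W°] is a fixed point of [T], so [x] lies in the interior of a
    subcontinuum contained in [W°], hence missing [T A]; thus [x] is not in
    [T (T A)]. The range of [T] is closed because the hyperspace is compact.

    Conversely, let [B] be a cluster point of [T A'] as [A'] tends to [A]. Then
    [B] contains [A], and [B] is contained in [T A] because [T] is always upper
    semicontinuous. If the range is closed, [B] is in it, so [T B = B] by
    idempotence and [T A] is contained in [T B = B]. By compactness of the
    hyperspace, [T A'] converges to [T A]. *)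
Require Import Defs.
From mathcomp Require Import all_boot all_order all_algebra.
From mathcomp Require Import all_classical all_reals all_analysis.

Set Implicit Arguments.
Unset Strict Implicit.
Unset Printing Implicit Defensive.

Import Order.TTheory GRing.Theory Num.Theory.

Local Open Scope classical_set_scope.
Local Open Scope ring_scope.

Section metric_sets.
Context {R : realType} {X : metricType R}.
Implicit Types (A W : set X) (x : X) (e : R).

Lemma near_mdist x e : 0 < e -> \forall y \near x, mdist x y < e.
Proof. by move=> e0; have := nbhsx_ballx x e e0; rewrite ballEmdist. Qed.

Lemma nbhs_mdistP x (U : set X) :
  nbhs x U -> exists2 e, 0 < e & forall y, mdist x y < e -> U y.
Proof.
move=> /nbhs_ballP[e /= e0 eU]; exists e => // y xy.
by apply: eU; rewrite ballEmdist.
Qed.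

Lemma open_thickening e A : open (thickening e A).
Proof.
apply: bigcup_open => a _; rewrite openE => x /= ax.
have d0 : 0 < e - mdist a x by rewrite subr_gt0.
apply: filterS (near_mdist x d0) => y xy /=.
by rewrite (le_lt_trans (metric_triangle a x y))// -ltrBrDl.
Qed.

Lemma thickening_le d e A :
  d <= e -> thickening d A `<=` thickening e A.
Proof. by move=> de x [a Aa /= ax]; exists a => //=; exact: lt_le_trans de. Qed.

Lemma jonesS A B : A `<=` B -> jones A `<=` jones B.
Proof.
move=> AB x TAx [W [cW Wx sW WB]]; apply: TAx.
by exists W; split => // y /WB + /AB.
Qed.

Lemma jones_interior A W : continuum W -> W `<=` ~` A -> jones A `<=` ~` W°.
Proof.
move=> cW WA x TAx Wx; apply: TAx.
by exists W; split => //; exact: interior_subset.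
Qed.

End metric_sets.

(** * Neighbourhoods and compactness in the hyperspace *)

Section hyperspace_topology.
Context {R : realType} {X : metricType R} {cX : continuum [set: X]}.
Local Notation H := (hyperspace cX).
Implicit Types (A B : H) (x : X) (e : R).

Lemma mdist_hyperspace_lt A B e : mdist A B < e ->
  hset A `<=` thickening e B.
Proof.
rewrite mdist_hyperspaceE => ABe.
have [|d [_ AB _] de] := inf_lt _ ABe.
  have [M M0 bM] := continuum_bounded cX.
  have [[a Aa] [b Bb]] := (hset_neq0 A, hset_neq0 B).
  by exists M; split => // x _; [exists b|exists a] => //; exact: bM.
by move=> x /AB; exact/thickening_le/ltW.
Qed.

Lemma near_hyperspace A e : 0 < e ->
  \forall B \near A, hset A `<=` thickening e (hset B) /\
                     hset B `<=` thickening e A.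
Proof.
move=> e0; apply: filterS (near_mdist A e0) => B AB.
by split; apply: mdist_hyperspace_lt; rewrite // metric_sym.
Qed.

Lemma nbhs_hyperspaceP A (S : set H) : nbhs A S ->
  exists2 e, 0 < e & forall B, hset A `<=` thickening e B ->
    hset B `<=` thickening e A -> S B.
Proof.
(* The inclusions bound the infimum only weakly; halving [e] restores strictness. *)
move=> /nbhs_mdistP[e e0 eS]; exists (e / 2); first exact: divr_gt0.
move=> B AB BA; apply: eS.
rewrite mdist_hyperspaceE (@le_lt_trans _ _ (e / 2))//.
  apply: ge_inf; first by exists 0 => d [/ltW].
  by split => //; exact: divr_gt0.
by rewrite ltr_pdivrMr// ltr_pMr// ltr1n.
Qed.

Lemma near_hyperspace_hit A x (U : set X) : hset A x -> nbhs x U ->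
  \forall B \near A, hset B `&` U !=set0.
Proof.
move=> Ax /nbhs_mdistP[e e0 eU]; apply: filterS (near_hyperspace A e0) => B.
move=> [AB _]; have [b Bb /= bx] := AB _ Ax.
by exists b; split => //; apply: eU; rewrite metric_sym.
Qed.

(** Joint in the point and the set, as the near-covering form of compactness requires. *)
Lemma near_hyperspace_notin A x : ~ hset A x ->
  \forall y \near x & B \near A, ~ hset B y.
Proof.
move=> Ax.
have /nbhs_mdistP[e e0 eA] : nbhs x (~` A).
  apply: open_nbhs_nbhs; split => //.
  by apply: closed_openC; exact: hset_closed.
have e20 : 0 < e / 2 by rewrite divr_gt0.
exists ([set y | mdist x y < e / 2],
        [set B : H | hset B `<=` thickening (e / 2) A]).
  split => /=; first exact: near_mdist.
  by apply: filterS (near_hyperspace A e20) => B [].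
move=> [y B] [/= xy BA] By; have [a Aa /= ay] := BA _ By.
apply: (eA a) => //; rewrite (le_lt_trans (metric_triangle x y a))//.
by rewrite (splitr e) ltrD// metric_sym.
Qed.

Lemma near_hyperspace_miss A (K : set X) : compact K -> K `<=` ~` A ->
  \forall B \near A, K `<=` ~` hset B.
Proof.
move=> /compact_near_coveringP cK KA.
apply: (cK H (nbhs A) (fun B y => ~ hset B y)) => x /KA.
exact: near_hyperspace_notin.
Qed.

(** An ultrafilter [F] converges to the set [L] of points all of whose balls are hit by [F]-almost
    every set. Compactness makes both halves of Hausdorff closeness uniform in the point. *)
Lemma compact_hyperspace : compact [set: H].
Proof.
have [cT _ _] := cX; have /compact_near_coveringP ncT := cT.
rewrite compact_ultra => F UF _.
pose hit x e := [set A : H | hset A `&` ball x e !=set0].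
pose L : set X := [set x | forall e, 0 < e -> F (hit x e)].
have missL x : ~ L x -> \forall y \near x & A \near F, ~ hset A y.
  move=> /existsNP[e /not_implyP[e0 Fe]].
  have [//|FCe] := in_ultra_setVsetC (hit x e) UF.
  exists (ball x e, ~` hit x e); first by split => //=; exact: nbhsx_ballx.
  by move=> [y A] [/= xy Axe] Ay; apply: Axe; exists y.
have clL : closed L.
  move=> x clx e e0; have e20 : 0 < e / 2 by rewrite divr_gt0.
  have [y [Ly xy]] := clx _ (nbhsx_ballx x _ e20).
  apply: filterS (Ly _ e20) => A [z [Az yz]]; exists z; split => //.
  by rewrite (splitr e); exact: ball_triangle xy yz.
(* Otherwise, by compactness, [F]-almost every set would miss all of [X], yet members of [H] are
   nonempty. *)
have FL0 : L !=set0.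
  apply: contrapT => L0.
  have : \forall A \near F, [set: X] `<=` ~` hset A.
    apply: (ncT H F (fun A y => ~ hset A y)) => x _; apply: missL => Lx.
    by apply: L0; exists x.
  move=> /filter_ex[A]; have [a Aa] := hset_neq0 A.
  by move=> /(_ a Logic.I).
exists (Hyperspace cX clL FL0); split => // S /nbhs_hyperspaceP[e e0 eS].
have e20 : 0 < e / 2 by rewrite divr_gt0.
have FAL : \forall A \near F,
    [set: X] `<=` [set y | hset A y -> thickening e L y].
  apply: (ncT H F (fun A y => hset A y -> thickening e L y)) => x _.
  have [Lx|/missL] := pselect (L x).
    exists ([set y | mdist x y < e], setT).
      by split => /=; [exact: near_mdist|exact: filterT].
    by move=> [y A] [/= xy _] _; exists x.
  by apply: filterS => -[y A] /=.
have FLA : \forall A \near F, L `<=` [set y | thickening e (hset A) y].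
  have /compact_near_coveringP ncL := subclosed_compact clL cT (@subsetT _ L).
  apply: (ncL H F (fun A y => thickening e (hset A) y)) => x /(_ _ e20) Fx.
  exists (ball x (e / 2), hit x (e / 2)).
    by split => //=; exact: nbhsx_ballx.
  move=> [y A] [/= xy [a [Aa xa]]]; exists a => //=.
  have := ball_triangle (ball_sym xa) xy; by rewrite -splitr ballEmdist.
apply: filterS2 FAL FLA => A AL LA.
by apply: eS => //= y Ay; exact: AL.
Qed.

(** Upper semicontinuity: a compact [W] missing [A] also misses all sets near [A], so one witness
    serves them all. *)
Lemma near_jones_notin A x : ~ jones A x ->
  \forall y \near x & B \near A, ~ jones (hset B) y.
Proof.
move=> /contrapT[W [cW Wx _ WA]]; have [cptW _ _] := cW.
exists (W°, [set B : H | W `<=` ~` hset B]).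
  split => /=; last exact: near_hyperspace_miss.
  by apply: open_nbhs_nbhs; split => //; exact: open_interior.
by move=> [y B] [/= Wy WB] /(jones_interior cW WB).
Qed.

(** The set [B] is the complement of a thin thickening of [W]. As [A] is the closure of the
    complement of [W], each of its points is close to a point at positive distance from [W];
    compactness of [A] yields a single radius [r]. *)
Lemma nbhs_setC_interior_miss A (W : set X) (S : set H) :
  compact W -> hset A = ~` W° -> nbhs A S ->
  exists2 B, S B & W `<=` ~` hset B.
Proof.
move=> cptW AW /nbhs_hyperspaceP[e e0 eS].
have clW : closed W by apply: compact_closed => //; exact: metric_hausdorff.
have e20 : 0 < e / 2 by rewrite divr_gt0.
have [cT _ _] := cX.
have /compact_near_coveringP ncA :=
  subclosed_compact (hset_closed (h := A)) cT (@subsetT _ A).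
have /filter_ex[r [r0 Ar]] : \forall r \near 0^'+, 0 < r /\
    hset A `<=` [set x | thickening e (~` thickening r W) x].
  apply: filterI; first exact: nbhs_right_gt.
  apply: (ncA R 0^'+ (fun r x => thickening e (~` thickening r W) x)) => x.
  rewrite AW -closure_setC => /(_ _ (near_mdist x e20))[y [Wy /= xy]].
  have /nbhs_mdistP[d d0 dW] : nbhs y (~` W).
    by apply: open_nbhs_nbhs; split => //; exact: closed_openC.
  exists ([set z | mdist x z < e / 2], [set r | r < d]).
    by split => /=; [exact: near_mdist|exact: nbhs_right_lt].
  move=> [z r] [/= xz rd]; exists y => /=.
    move=> [w Ww /= wy]; apply: (dW w) => //.
    by rewrite metric_sym (lt_trans wy).
  rewrite (le_lt_trans (metric_triangle y x z))//.
  by rewrite (splitr e) ltrD// metric_sym.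
have clB : closed (~` thickening r W).
  by apply: open_closedC; exact: open_thickening.
have WB : W `<=` thickening r W by move=> w Ww; exists w; rewrite //= mdistxx.
have B0 : ~` thickening r W !=set0.
  by have [a /Ar[b Bb _]] := hset_neq0 A; exists b.
exists (Hyperspace cX clB B0) => /=; last by move=> w /WB rw; exact.
apply: eS => //= b rb; exists b; rewrite /= ?mdistxx// AW.
by move=> /interior_subset/WB.
Qed.

End hyperspace_topology.

(** * The two implications *)

Section continuity.
Context {R : realType} {X : metricType R} {cX : continuum [set: X]}.
Local Notation H := (hyperspace cX).
Local Notation T := (jones_hyperspace cX).
Implicit Types A B : H.

Lemma jones_setC_interior (W : set X) : continuous T -> continuum W ->
  ~` W° !=set0 -> jones (~` W°) `<=` ~` W°.
Proof.
move=> cT cW W0 x Tx Wx; have [cptW _ _] := cW.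
have clW : closed (~` W°) by apply: open_closedC; exact: open_interior.
pose A := Hyperspace cX clW W0.
have : \forall B \near A, jones (hset B) `&` W° !=set0.
  have TA : hset (T A) x by [].
  apply: (cT A [set B : H | hset B `&` W° !=set0]).
  apply: near_hyperspace_hit TA _.
  by apply: open_nbhs_nbhs; split => //; exact: open_interior.
(* Some [B] this near misses [W], which forces [jones B] off the interior of [W]. *)
move=> /(nbhs_setC_interior_miss cptW (erefl (hset A)))[B [y [By Wy]] WB].
exact: jones_interior WB _ By Wy.
Qed.

Lemma continuous_jones_idempotent : continuous T -> idempotent_on_closed X.
Proof.
move=> cT A clA A0; apply/seteqP; split; last exact: subset_jones.
move=> x TTx; apply: contrapT => /contrapT[W [cW Wx sW WA]].
have AW : A `<=` ~` W° by move=> y Ay /sW/WA.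
have TW := jones_setC_interior cT cW (subset_nonempty AW A0).
have /contrapT[M [cM Mx sM MW]] : ~ jones (~` W°) x by move=> /TW.
apply: TTx; exists M; split => // y /MW/contrapT Wy Ty.
by apply: TW Wy; exact: jonesS Ty.
Qed.

Lemma continuous_closed_range_jones : continuous T -> closed (range T).
Proof.
move=> cT; apply: compact_closed; first exact: metric_hausdorff.
apply: continuous_compact; last exact: compact_hyperspace.
exact: continuous_subspaceT.
Qed.

(** A point of [A] off [B] has a neighbourhood missed by all sets near [B] but met by [T C] for [C]
    near [A], since [T C] contains [C]. A point of [B] off [T A] has one met by all sets near [B]
    but missed by [T D] for [D] near [A]. *)
Lemma cluster_jones A B : cluster (T @ A) B ->
  hset A `<=` hset B /\ hset B `<=` jones A.
Proof.
move=> clB; split=> x.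
  move=> Ax; apply: contrapT => /near_hyperspace_notin[[U V] /= [Ux VB] UV].
  have [|C [[y [Cy Uy]]] VC] := clB [set C | hset C `&` U !=set0] V _ VB.
    apply: filterS (near_hyperspace_hit Ax Ux) => C [y [Cy Uy]].
    by exists y; split => //; exact: subset_jones.
  exact: (UV (y, C)).
move=> Bx; apply: contrapT => /near_jones_notin[[U V] /= [Ux VA] UV].
have [|C [[D VD DC] [y [Cy Uy]]]] :=
  clB (T @` V) [set C | hset C `&` U !=set0] _ (near_hyperspace_hit Bx Ux).
  by apply: filterS VA => D VD; exists D.
by apply: (UV (y, D)) => //=; rewrite -[jones _]/(hset (T D)) DC.
Qed.

Lemma idempotent_closed_range_continuous :
  idempotent_on_closed X -> closed (range T) -> continuous T.
Proof.
move=> idT clT A.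
have clE B : cluster (T @ A) B -> B = T A.
  move=> clB; have [AB BA] := cluster_jones clB.
  have [C _ TC] : range T B.
    apply: clT => N; apply: clB.
    by apply: (filterE (F := nbhs A)) => C; exists C.
  have TB : jones B = B.
    by rewrite -TC /=; apply: idT; [exact: hset_closed|exact: hset_neq0].
  apply: hyperspace_ext; apply/seteqP; split => //.
  by rewrite -TB; exact: jonesS.
have PF : ProperFilter (T @ A) by exact: (@fmap_proper_filter _ _ T (nbhs A)).
(* A cluster point exists by compactness and can only be [T A]; a filter on a compact Hausdorff
   space with a single cluster point converges to it. *)
have clTA : cluster (T @ A) = [set T A].
  apply/seteqP; split => [B /clE//|_ ->].
  have [B [_ clB]] := compact_hyperspace PF filterT.
  by rewrite -(clE _ clB).
exact: (compact_cluster_set1 (@metric_hausdorff _ H) compact_hyperspace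
  filterT PF filterT clTA).
Qed.

End continuity.

Theorem theorem3p2 (R : realType) (X : metricType R)
    (cX : continuum [set: X]) :
  continuous (jones_hyperspace cX) <->
  idempotent_on_closed X /\ closed (range (jones_hyperspace cX)).
Proof.
split=> [cT|[idT clT]]; last exact: idempotent_closed_range_continuous.
split; first exact: continuous_jones_idempotent cT.
exact: continuous_closed_range_jones.
Qed.
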